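(* Let $k$ be a positive integer, let $u$ be a unitary in $\mathcal{F}_n^k$ and let $z$ be a unitary in $\mathcal{F}_n^1$. If $u(z\mathcal{D}_n^1z^* )u^*=\varphi^{k-1}(z\mathcal{D}_n^1z^* )$ then $\mathcal{A}=\lambda_z(\mathcal{D}_n)$ is $\lambda_u$-invariant, i.e. $\lambda_u(\mathcal{A})\subseteq\mathcal{A}$.
   Context: Let $n\ge 2$ be an integer and let $\mathcal{O}_n$ be the Cuntz algebra, generated by isometries $S_1,\ldots,S_n$ with $\sum_{i=1}^n S_iS_i^*=I$. For a multi-index $\alpha=(\alpha_1,\ldots,\alpha_k)\in\{1,\ldots,n\}^k$ put $S_\alpha=S_{\alpha_1}\cdots S_{\alpha_k}$. $\mathcal{F}_n^k$ is the span of $S_\alpha S_\beta^*$ with $\alpha,\beta\in\{1,\ldots,n\}^k$ (isomorphic to $M_{n^k}(\mathbb{C})$). $\mathcal{D}_n$ is the $C^*$-subalgebra of $\mathcal{O}_n$ generated by all projections $S_\alpha S_\alpha^*$ over all multi-indices $\alpha$, and $\mathcal{D}_n^1=\mathcal{D}_n\cap\mathcal{F}_n^1=\operatorname{span}\{S_iS_i^*\}$. The canonical shift is $\varphi(x)=\sum_{i=1}^n S_ixS_i^*$, with $\varphi^0=\mathrm{id}$. For a unitary $w\in\mathcal{O}_n$, $\lambda_w$ is the unital $*$-endomorphism of $\mathcal{O}_n$ determined by $\lambda_w(S_i)=wS_i$, $i=1,\ldots,n$. *)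

(* Defs.v *)
From HB Require Import structures.
From mathcomp Require Import all_boot all_order all_algebra.
From mathcomp Require Import all_classical all_reals all_analysis.
From mathcomp Require Export complex.

Set Implicit Arguments.
Unset Strict Implicit.
Unset Printing Implicit Defensive.

Import Order.TTheory GRing.Theory Num.Theory.
Import numFieldNormedType.Exports.

Local Open Scope classical_set_scope.
Local Open Scope ring_scope.

(* Unital complex C*-algebras, with real-valued norm. The norm is part of the
   mixin because the hierarchy has no structure that is both a ring and a
   normed module. Nontriviality (1 != 0) comes from GRing.Algebra. *)
HB.mixin Record isCStar (R : realType) A of GRing.Algebra R[i] A := {
  star : A -> A;
  cnorm : A -> R;
  starK : involutive star;
  starD : {morph star : x y / x + y};
  starZ : forall (a : R[i]) (x : A), star (a *: x) = a^* *: star x;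
  starM : forall x y : A, star (x * y) = star y * star x;
  cnorm_eq0 : forall x : A, cnorm x = 0 -> x = 0;
  cnormD : forall x y : A, cnorm (x + y) <= cnorm x + cnorm y;
  cnormZ : forall (a : R[i]) (x : A), cnorm (a *: x) = complex.Re `|a| * cnorm x;
  cnormM : forall x y : A, cnorm (x * y) <= cnorm x * cnorm y;
  cnorm_star : forall x : A, cnorm (star x * x) = cnorm x ^+ 2;
  cnorm_complete : forall x : nat -> A,
    (forall e : R, 0 < e ->
       \forall p \near \oo & q \near \oo, cnorm (x p - x q) < e) ->
    exists l : A, cnorm (x p - l) @[p --> \oo] --> (0 : R)
}.

#[short(type="cstarAlgType")]
HB.structure Definition CStarAlgebra (R : realType) :=
  {A of GRing.Algebra R[i] A & isCStar R A}.

Section CStar.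
Context {R : realType} {A : cstarAlgType R}.

Definition unitary (u : A) := star u * u = 1 /\ u * star u = 1.

Definition norm_closure (B : set A) : set A :=
  [set x | forall e : R, 0 < e -> exists2 y, B y & cnorm (x - y) < e].

Definition cstar_subalgebra (B : set A) :=
  [/\ B 0,
      forall (a : R[i]) x y, B x -> B y -> B (a *: x + y),
      forall x y, B x -> B y -> B (x * y),
      forall x, B x -> B (star x)
    & norm_closure B `<=` B].

Definition cstar_generated (G : set A) : set A := smallest cstar_subalgebra G.

Definition conj_set (u : A) (X : set A) : set A :=
  [set u * x * star u | x in X].

End CStar.

Section Cuntz.
Context {R : realType} {A : cstarAlgType R} {n : nat}.
Variable S : 'I_n -> A.

(* A is the Cuntz algebra O_n with canonical generating isometries S; for
   n >= 2 this determines (A, S) up to isomorphism. *)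
Definition cuntz_algebra :=
  [/\ forall i, star (S i) * S i = 1,
      \sum_i S i * star (S i) = 1
    & cstar_generated (range S) = setT].

Definition word (s : seq 'I_n) : A := \prod_(i <- s) S i.

Definition Fk (k : nat) : set A :=
  [set x | exists c : k.-tuple 'I_n -> k.-tuple 'I_n -> R[i],
     x = \sum_alpha \sum_beta c alpha beta *: (word alpha * star (word beta))].

Definition Dn : set A :=
  cstar_generated (range (fun s : seq 'I_n => word s * star (word s))).

Definition Dk (k : nat) : set A := Dn `&` Fk k.

Definition cuntz_shift (x : A) : A := \sum_i S i * x * star (S i).

(* f is lambda_w: the linearity, multiplicativity and unitality of f are part
   of its type. *)
Definition is_lambda (w : A) (f : {lrmorphism A -> A}) :=
  (forall x, f (star x) = star (f x)) /\ (forall i, f (S i) = w * S i).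

End Cuntz.

(* Main.v *)
(* The projections [S_s S_s^*] generate [D_n] and satisfy
   [P_(i s) = P_i phi(P_s)], so it suffices to control [lambda_u] on the
   elements [phi^j (z P_i z^* )] of [A = lambda_z(D_n)]. Since [F_n^k] commutes
   with the range of [phi^k], the hypothesis propagates by induction on [j]
   through [lambda_u (phi x) = u phi(lambda_u x) u^*], and [lambda_u] maps
   [phi^j (z D_n^1 z^* )] into [phi^(j+k-1) (z D_n^1 z^* )], a subset of [A].
   The passage to closures needs two facts. First, *-endomorphisms are
   contractive: a self-adjoint [h] with [|h| < 1] is the real part of the
   unitary [h + i sqrt(1 - h^2)]. Second, [lambda_z(D_n)] is closed: on the
   algebraic span of the projections, [lambda_z] is a unitary conjugation,
   hence isometric. *)
Require Import Defs.
From mathcomp Require Import all_boot all_order all_algebra.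
From mathcomp Require Import all_classical all_reals all_analysis.
From mathcomp Require Import ring lra.

Import Order.TTheory GRing.Theory Num.Theory.
Import numFieldNormedType.Exports.

Local Open Scope classical_set_scope.
Local Open Scope ring_scope.

(** * Norm and involution in a C*-algebra *)

Section CStarTheory.
Context {R : realType} {A : cstarAlgType R}.
Implicit Types (x y z h t : A) (B G : set A).

Lemma star0 : star 0 = 0 :> A.
Proof. by rewrite -(scale0r (0 : A)) starZ conjC0 !scale0r. Qed.

Lemma starN x : star (- x) = - star x.
Proof. by apply/eqP; rewrite -addr_eq0 -starD addNr star0. Qed.

Lemma starB x y : star (x - y) = star x - star y.
Proof. by rewrite starD starN. Qed.

Lemma star1 : star 1 = 1 :> A.
Proof. by rewrite -[LHS]mulr1 -{2}(starK 1) -starM mulr1 starK. Qed.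

Lemma star_sum (I : Type) (r : seq I) (F : I -> A) :
  star (\sum_(i <- r) F i) = \sum_(i <- r) star (F i).
Proof. exact: (big_morph _ starD star0). Qed.

Lemma cnorm_scale (c : R) x : 0 <= c -> cnorm (c%:C%C *: x) = c * cnorm x.
Proof. by move=> c0; rewrite cnormZ ger0_norm ?lecR. Qed.

Lemma cnorm_double x : cnorm (x + x) = 2 * cnorm x.
Proof.
have -> : x + x = 2%:C%C *: x by rewrite -mulr2n -scaler_nat rmorph_nat.
exact: cnorm_scale.
Qed.

Lemma cnorm0 : cnorm (0 : A) = 0.
Proof. by rewrite -(scale0r (0 : A)) cnormZ normr0 mul0r. Qed.

Lemma cnormN x : cnorm (- x) = cnorm x.
Proof. by rewrite -scaleN1r cnormZ normrN1 mul1r. Qed.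

Lemma cnormB x y : cnorm (x - y) = cnorm (y - x).
Proof. by rewrite -opprB cnormN. Qed.

Lemma cnorm_ge0 x : 0 <= cnorm x.
Proof. by have := cnormD x (- x); rewrite subrr cnorm0 cnormN; lra. Qed.

Lemma cnorm_triangle y x z : cnorm (x - z) <= cnorm (x - y) + cnorm (y - z).
Proof. by rewrite -[x - z](subrKA y) cnormD. Qed.

Lemma cnorm_le_add x y : cnorm x <= cnorm y + cnorm (x - y).
Proof. by have := cnorm_triangle y x 0; rewrite !subr0 addrC. Qed.

(** The C*-identity gives [|y|^2 = |y^* y| <= |y^*| |y|]; dividing by [|y|] and exchanging [y] with
    [y^*] yields equality. *)
Lemma cnorm_eq_star x : cnorm (star x) = cnorm x.
Proof.
have le y : cnorm y <= cnorm (star y).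
  have [-> | y0] := eqVneq (cnorm y) 0; first exact: cnorm_ge0.
  have yp : 0 < cnorm y by rewrite lt0r y0 cnorm_ge0.
  by rewrite -(ler_pM2r yp) -expr2 -cnorm_star cnormM.
by apply/eqP; rewrite eq_le le -{2}[x]starK le.
Qed.

Lemma cnorm1_le : cnorm (1 : A) <= 1.
Proof.
have := cnorm_star (1 : A); rewrite star1 mulr1; have := cnorm_ge0 1; nra.
Qed.

Lemma cnorm_isometry_le (w : A) : star w * w = 1 -> cnorm w <= 1.
Proof.
move=> ww; have := cnorm_star w; rewrite ww.
by have := cnorm1_le; have := cnorm_ge0 w; nra.
Qed.

Lemma cnorm_conj_le (v x : A) :
  cnorm v <= 1 -> cnorm (star v * x * v) <= cnorm x.
Proof.
move=> v1; apply: le_trans (cnormM _ _) _.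
apply: (@le_trans _ _ (cnorm (star v * x))).
  by rewrite ler_piMr ?cnorm_ge0.
apply: le_trans (cnormM _ _) _.
by rewrite cnorm_eq_star ler_piMl ?cnorm_ge0.
Qed.

Lemma cnorm_sum_le (I : finType) (P : pred I) (F : I -> A) (M : R) :
  (forall i, P i -> cnorm (F i) <= M) ->
  cnorm (\sum_(i | P i) F i) <= #|P|%:R * M.
Proof.
move=> FM; apply: (@le_trans _ _ (\sum_(i | P i) M)).
  elim/big_rec2: _ => [|i M' y Pi yM]; first by rewrite cnorm0.
  by apply: le_trans (cnormD _ _) _; rewrite lerD ?FM.
by rewrite sumr_const mulr_natl.
Qed.

Lemma cnorm_small_eq0 x : (forall e : R, 0 < e -> cnorm x <= e) -> x = 0.
Proof.
move=> small; apply/cnorm_eq0/eqP; rewrite eq_le cnorm_ge0 andbT.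
by apply/ler_addgt0Pl => e /small; rewrite addr0.
Qed.

Lemma sub_sqr x y : x * x - y * y = x * (x - y) + (x - y) * y.
Proof. by rewrite mulrBr mulrBl addrA subrK. Qed.

Lemma cnorm_sub_sqr (r : R) x y : cnorm x <= r -> cnorm y <= r ->
  cnorm (x * x - y * y) <= (r + r) * cnorm (x - y).
Proof.
move=> xr yr; rewrite sub_sqr; apply: le_trans (cnormD _ _) _.
have := cnormM x (x - y); have := cnormM (x - y) y.
by have := cnorm_ge0 (x - y); nra.
Qed.

(** * Square roots of [1 - a] for [|a| < 1] *)

Section SquareRoot.
Variable a : A.
Let r := cnorm a.
Hypothesis r1 : r < 1.

Let F x : A := (2^-1)%:C%C *: (a + x * x).
Let r0 : 0 <= r. Proof. exact: cnorm_ge0. Qed.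

Let normF x : cnorm x <= r -> cnorm (F x) <= r.
Proof.
move=> xr; rewrite cnorm_scale ?invr_ge0//.
have := cnormD a (x * x); have := cnormM x x; have := cnorm_ge0 x.
rewrite -/r; have := r0; have := r1; nra.
Qed.

Let contrF x y : cnorm x <= r -> cnorm y <= r ->
  cnorm (F x - F y) <= r * cnorm (x - y).
Proof.
move=> xr yr; rewrite -scalerBr opprD addrACA subrr add0r.
by rewrite cnorm_scale ?invr_ge0//; have := cnorm_sub_sqr _ _ _ xr yr; lra.
Qed.

Let T m := iter m F 0.

Let normT m : cnorm (T m) <= r.
Proof. by elim: m => [|m IH]; [rewrite cnorm0 | exact: normF]. Qed.

(** [F] preserves the ball of radius [r], since [(r + r^2) / 2 <= r], and is [r]-Lipschitz on it;
    the iterates from 0 are therefore Cauchy at a geometric rate. *)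
Let shiftT m p : cnorm (T (m + p)%N - T m) <= r ^+ m.
Proof.
elim: m => [|m IH]; first by rewrite subr0; apply: le_trans (ltW r1).
apply: le_trans (contrF _ _ (normT _) (normT _)) _.
by rewrite exprS ler_wpM2l.
Qed.

Let cvgT : exists l : A, cnorm (T p - l) @[p --> \oo] --> (0 : R).
Proof.
apply: cnorm_complete => e e0.
have e20 : 0 < e / 2 by rewrite divr_gt0.
have /cvgrPdist_lt /(_ _ e20) [N _ HN] : (fun m => r ^+ m) @ \oo --> (0 : R).
  by apply: cvg_expr; rewrite ger0_norm.
have {}HN p : (N <= p)%N -> cnorm (T p - T N) < e / 2.
  move=> Np; rewrite -(subnKC Np); apply: le_lt_trans (shiftT _ _) _.
  by have := HN N (leqnn N); rewrite /= sub0r normrN ger0_norm ?exprn_ge0.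
exists ([set p | N <= p]%N, [set p | N <= p]%N) => /=.
  by split; exists N.
move=> [p q] [/= /HN pN /HN qN].
have := cnorm_triangle (T N) (T p) (T q).
rewrite [cnorm (T N - _)]cnormB; lra.
Qed.

(* The fixed point of [t |-> (a + t^2) / 2], so that [(1 - t)^2 = 1 - a]. *)
Lemma sqrt_fixpoint : exists t, cnorm t <= cnorm a /\ t + t = a + t * t.
Proof.
have [l Tl] := cvgT.
have {}Tl (e : R) : 0 < e -> exists N, forall p, (N <= p)%N ->
    cnorm (T p - l) < e.
  move=> e0; move/cvgrPdist_lt: Tl => /(_ _ e0) [N _ HN].
  exists N => p /HN /=; rewrite sub0r normrN ger0_norm ?cnorm_ge0//.
have lr : cnorm l <= r.
  apply/ler_addgt0Pr => e /Tl [N /(_ N (leqnn N))].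
  have := cnorm_le_add l (T N); have := normT N; rewrite cnormB; lra.
exists l; split => //.
have Fl : l = F l.
  apply/subr0_eq/cnorm_small_eq0 => e e0.
  have e20 : 0 < e / 2 by rewrite divr_gt0.
  have [N HN] := Tl _ e20.
  have := HN _ (leqnSn N); have := HN _ (leqnn N).
  have := contrF _ _ (normT N) lr; rewrite -/(T N.+1).
  have := cnorm_triangle (T N.+1) l (F l); rewrite [cnorm (l - T _)]cnormB.
  have := cnorm_ge0 (T N - l); have := r0; have := r1; nra.
rewrite {1 2}Fl -scalerDl -rmorphD /=.
suff -> : 2^-1 + 2^-1 = 1 :> R by rewrite scale1r.
by field.
Qed.

End SquareRoot.

(** The root is [1 - t] for the fixed point [t]. By the fixed-point equation, both [star t - t] and
    the commutator of [y] with [t] satisfy [|d + d| <= 2 |t| |d|], hence vanish as [|t| < 1]. *)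
Lemma sqrt_one_sub (a : A) : star a = a -> cnorm a < 1 ->
  exists s, [/\ star s = s, s * s = 1 - a
    & forall y, y * a = a * y -> y * s = s * y].
Proof.
move=> aa a1; have [t [ta tE]] := sqrt_fixpoint _ a1.
have {a1}t1 : cnorm t < 1 by apply: le_lt_trans a1.
have contr_eq0 (d : A) :
    cnorm (d + d) <= (cnorm t + cnorm t) * cnorm d -> d = 0.
  by rewrite cnorm_double => dc; apply/cnorm_eq0; have := cnorm_ge0 d; nra.
have tt : star t = t.
  apply/subr0_eq/contr_eq0.
  have E : star t + star t = a + star t * star t.
    by rewrite -starD tE starD !starM aa.
  have -> : star t - t + (star t - t) = star t * star t - t * t.
    by rewrite addrACA -opprD E tE opprD addrACA subrr add0r.
  by apply: cnorm_sub_sqr; rewrite ?cnorm_eq_star.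
exists (1 - t); split; first by rewrite starB star1 tt.
  rewrite mulrBl mul1r mulrBr mulr1 opprB [t * t - t]addrC addrA.
  by rewrite -[1 - t - t]addrA -opprD tE opprD addrA subrK.
move=> y ya; suff yt : y * t = t * y by rewrite mulrBr mulrBl mulr1 mul1r yt.
apply/subr0_eq/contr_eq0; set d := y * t - t * y.
have -> : d + d = d * t + t * d.
  rewrite /d addrACA -opprD -mulrDr -mulrDl tE mulrDr mulrDl opprD.
  rewrite addrACA ya subrr add0r mulrBl mulrBr !mulrA.
  by rewrite addrA subrK.
apply: le_trans (cnormD _ _) _.
by have := cnormM d t; have := cnormM t d; lra.
Qed.

(** * Real and imaginary parts, and extremality of the unit *)

Lemma sqr_cartesian x y : star x = x -> star y = y -> x * y = y * x ->
  star (x + 'i *: y) * (x + 'i *: y) = x * x + y * y.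
Proof.
move=> xx yy xy; rewrite starD starZ conjCi xx yy scaleNr.
rewrite mulrBl !mulrDr -!scalerAl -!scalerAr scalerA -['i * 'i]expr2 sqrCi xy.
by rewrite opprD addrA addrK scaleN1r opprK.
Qed.

Lemma star_cartesian x y : star x = x -> star y = y ->
  star (x + 'i *: y) = x - 'i *: y.
Proof. by move=> xx yy; rewrite starD starZ conjCi xx yy scaleNr. Qed.

(** Twice ['i *: y] is [v - star v], and [star] is isometric. *)
Lemma cnorm_imaginary_le x y : star x = x -> star y = y ->
  cnorm y <= cnorm (x + 'i *: y).
Proof.
move=> xx yy; set v := x + _; have := cnormD v (- star v).
rewrite cnormN cnorm_eq_star {1}/v star_cartesian// opprB addrC addrA subrK.
by rewrite cnorm_double cnormZ normCi mul1r; lra.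
Qed.

(* A self-adjoint element of norm < 1 is the real part of a unitary. *)
Lemma unitary_dilation h : star h = h -> cnorm h < 1 ->
  exists w, star w * w = 1 /\ w + star w = h + h.
Proof.
move=> hh h1.
have h2 : cnorm (h * h) < 1.
  by have := cnormM h h; have := cnorm_ge0 h; nra.
have [|s [ss s2 hs]] := sqrt_one_sub (h * h) _ h2; first by rewrite starM hh.
have {}hs : h * s = s * h by apply: hs; rewrite mulrA.
exists (h + 'i *: s); split; first by rewrite sqr_cartesian// s2 addrC subrK.
by rewrite star_cartesian// addrACA subrr addr0.
Qed.

(* Otherwise, with [1 - b^2 (1 + c^2) = s^2] for [b < 1] near 1, the element
   [s + i b c] has squared norm at most [1 - b^2], which is too small. *)
Lemma one_extreme (c : A) : star c = c -> cnorm (1 + c) <= 1 ->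
  cnorm (1 - c) <= 1 -> c = 0.
Proof.
move=> cc p1 m1.
have x1 : cnorm c <= 1.
  have := cnormD (1 + c) (- (1 - c)); rewrite cnormN opprB [1 + c]addrC.
  rewrite addrACA subrr addr0 cnorm_double [c + 1]addrC; lra.
have sq1 : cnorm (1 + c * c) <= 1.
  have sq y : (1 + y) * (1 + y) = (1 + y * y) + (y + y).
    by rewrite mulrDl mul1r mulrDr mulr1 [y + y * y]addrC addrACA.
  have := cnorm_double (1 + c * c).
  have -> : 1 + c * c + (1 + c * c) = (1 + c) * (1 + c) + (1 - c) * (1 - c).
    by rewrite !sq mulrNN [RHS]addrACA [c + c + _]addrACA subrr addr0 addr0.
  have := cnormD ((1 + c) * (1 + c)) ((1 - c) * (1 - c)).
  have := cnormM (1 + c) (1 + c); have := cnormM (1 - c) (1 - c).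
  by have := cnorm_ge0 (1 + c); have := cnorm_ge0 (1 - c); nra.
apply/cnorm_eq0/eqP; apply/contraT => x0.
have {}x0 : 0 < cnorm c by rewrite lt0r x0 cnorm_ge0.
set X := cnorm c ^+ 2; have X0 : 0 < X by rewrite exprn_gt0.
have X1 : X <= 1 by rewrite expr_le1 ?cnorm_ge0.
(* This [b] is below 1 and still satisfies [b^2 (1 + X) > 1] for all [0 < X <= 1], which contradicts
   the bound [b^2 X <= 1 - b^2] reached below. *)
pose b := 1 - X / 4; have b0 : 0 < b by rewrite /b; lra.
have b1 : b < 1 by rewrite /b; lra.
pose d := b%:C%C *: c.
have dd : star d = d by rewrite starZ cc; congr (_ *: _); exact: conjc_real.
have aE : (b * b)%:C%C *: (1 + c * c) = (b * b)%:C%C *: 1 + d * d.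
  by rewrite scalerDr /d -scalerAl -scalerAr scalerA -rmorphM.
have [||s [ss s2 sd]] := sqrt_one_sub ((b * b)%:C%C *: (1 + c * c)).
- by rewrite starZ starD star1 starM cc; congr (_ *: _); exact: conjc_real.
- have bb1 : b * b < 1 by nra.
  rewrite cnorm_scale ?mulr_ge0 ?(ltW b0)//.
  by have := cnorm_ge0 (1 + c * c); nra.
have {}sd : s * d = d * s.
  apply/esym/sd; rewrite aE; move: d ((b * b)%:C%C) {aE dd sd s2} => e q.
  by rewrite mulrDr mulrDl -scalerAl -scalerAr mulr1 mul1r mulrA.
have := sqr_cartesian _ _ ss dd sd; rewrite s2 aE opprD addrA subrK => vE.
have := cnorm_star (s + 'i *: d); rewrite vE.
have -> : 1 - (b * b)%:C%C *: 1 = (1 - b * b)%:C%C *: (1 : A).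
  by rewrite rmorphB rmorph1 scalerBl scale1r.
rewrite cnorm_scale; last by nra.
have := cnorm_imaginary_le _ _ ss dd; rewrite cnorm_scale ?(ltW b0)//.
set v := cnorm (s + _) => bv v2.
have {}v2 : v ^+ 2 <= 1 - b * b.
  have n1 := cnorm1_le; rewrite -v2.
  by rewrite ler_piMr// subr_ge0; nra.
have : (b * cnorm c) ^+ 2 <= v ^+ 2.
  by rewrite ler_sqr ?nnegrE ?cnorm_ge0// mulr_ge0 ?cnorm_ge0// ltW.
rewrite exprMn -/X => bX.
have : b ^+ 2 * (1 + X) <= 1 by lra.
have -> : b ^+ 2 * (1 + X) = 1 + X * (1 / 2 - X * 7 / 16 + X ^+ 2 / 16).
  by rewrite /b; field.
by rewrite gerDl pmulr_rle0//; have := sqr_ge0 X; lra.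
Qed.

(** * Contractivity of *-endomorphisms *)

Lemma cnorm_projection_le (e : A) : star e * e = e -> cnorm e <= 1.
Proof.
by move=> ee; have := cnorm_star e; rewrite ee; have := cnorm_ge0 e; nra.
Qed.

(** For self-adjoint [h] in the open unit ball, [f] sends an isometry with real part [h] to an
    isometry. Scaling covers all self-adjoint elements, and the C*-identity reduces the general case
    to [star x * x]. *)
Lemma star_rmorph_contractive (f : {lrmorphism A -> A}) x :
  (forall y, f (star y) = star (f y)) -> cnorm (f x) <= cnorm x.
Proof.
move=> fs.
have unit_ball h : star h = h -> cnorm h < 1 -> cnorm (f h) <= 1.
  move=> hh /(unitary_dilation _ hh) [w [ww wh]].
  have fw : cnorm (f w) <= 1.
    by apply: cnorm_isometry_le; rewrite -fs -rmorphM ww rmorph1.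
  have := cnormD (f w) (star (f w)).
  rewrite -fs -raddfD wh raddfD fs cnorm_eq_star cnorm_double; lra.
have sa h : star h = h -> cnorm (f h) <= cnorm h.
  move=> hh; apply/ler_addgt0Pl => e e0.
  (* The summand [e] keeps [c] positive even for [h = 0] and puts [h / c] in the open unit ball. *)
  set c := e + cnorm h; have c0 : 0 < c by have := cnorm_ge0 h; rewrite /c; lra.
  have ic0 : 0 <= c^-1 by rewrite invr_ge0 ltW.
  have := unit_ball ((c^-1)%:C%C *: h).
  rewrite starZ hh linearZ /= !cnorm_scale//.
  rewrite !ler_pdivrMl// !ltr_pdivrMl// !mulr1.
  by apply; [congr (_ *: _); exact: conjc_real | rewrite /c; lra].
rewrite -[leLHS]ger0_norm ?cnorm_ge0// -[leRHS]ger0_norm ?cnorm_ge0//.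
rewrite -ler_sqr ?nnegrE ?normr_ge0// !real_normK ?num_real//.
by rewrite -!cnorm_star -fs -rmorphM; apply: sa; rewrite starM starK.
Qed.
End CStarTheory.

(** * C*-subalgebras: generation, preimages, closures and images *)

Section Subalgebras.
Context {R : realType} {A : cstarAlgType R}.
Implicit Types (x y : A) (B G : set A).

Lemma sub_cstar_generated G : G `<=` cstar_generated G.
Proof. exact: sub_smallest. Qed.

Lemma cstar_generated_min G B :
  cstar_subalgebra B -> G `<=` B -> cstar_generated G `<=` B.
Proof. by move=> cB GB; apply: smallest_sub. Qed.

Lemma cstar_generated_subalgebra G : cstar_subalgebra (cstar_generated G).
Proof.
split.
- by move=> B [[]].
- move=> a x y Gx Gy B BG; have [[_ lin _ _ _] _] := BG.
  by apply: lin; [exact: Gx | exact: Gy].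
- move=> x y Gx Gy B BG; have [[_ _ mul _ _] _] := BG.
  by apply: mul; [exact: Gx | exact: Gy].
- by move=> x Gx B BG; have [[_ _ _ st _] _] := BG; apply: st; exact: Gx.
- move=> x clx B BG; have [[_ _ _ _ cl] _] := BG.
  by apply: cl => e /clx [y Gy xy]; exists y => //; exact: Gy.
Qed.

(** Stated for a bare map with an explicit bound, so as to apply both to the shift and to the
    composite of [lambda_u] and [lambda_z]. *)
Lemma cstar_subalgebra_preimage (f : A -> A) (M : R) B :
    (forall a x y, f (a *: x + y) = a *: f x + f y) ->
    (forall x y, f (x * y) = f x * f y) ->
    (forall x, f (star x) = star (f x)) ->
    0 < M -> (forall x, cnorm (f x) <= M * cnorm x) ->
  cstar_subalgebra B -> cstar_subalgebra [set x | B (f x)].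
Proof.
move=> fl fm fs M0 fM [B0 Bl Bm Bs Bcl].
have fB x y : f (x - y) = f x - f y.
  by rewrite addrC -scaleN1r fl scaleN1r addrC.
split => /=.
- by rewrite -(subrr 0) fB subrr.
- by move=> a x y ? ?; rewrite fl; apply: Bl.
- by move=> x y ? ?; rewrite fm; apply: Bm.
- by move=> x ?; rewrite fs; apply: Bs.
move=> x clx; apply: Bcl => e e0.
have [y /= By xy] := clx (e / M) (divr_gt0 e0 M0).
exists (f y) => //; rewrite -fB; apply: le_lt_trans (fM _) _.
by rewrite mulrC -ltr_pdivlMr.
Qed.

(** Used to show that [D_n] lies in the closure of a *-subalgebra on which [lambda_w] is
    explicit. *)
Lemma cstar_subalgebra_norm_closure G : G 0 ->
    (forall (a : R[i]) x y, G x -> G y -> G (a *: x + y)) ->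
    (forall x y, G x -> G y -> G (x * y)) ->
    (forall x, G x -> G (star x)) ->
  cstar_subalgebra (norm_closure G).
Proof.
move=> G0 Gl Gm Gs; split.
- by move=> e e0; exists 0 => //; rewrite subr0 cnorm0.
- move=> a x y clx cly e e0.
  pose M := complex.Re `|a|.
  have M0 : 0 <= M by have := normr_ge0 a; rewrite lecE => /andP[].
  have e20 : 0 < e / 2 by rewrite divr_gt0.
  have M1 : 0 < M + 1 by rewrite ltr_wpDl.
  have [x' Gx xx'] := clx _ (divr_gt0 e20 M1).
  have [y' Gy yy'] := cly _ e20.
  exists (a *: x' + y'); first exact: Gl.
  rewrite opprD addrACA -scalerBr; apply: le_lt_trans (cnormD _ _) _.
  rewrite cnormZ -/M.
  move: xx'; rewrite ltr_pdivlMr//.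
  by rewrite mulrDr mulr1 mulrC; have := cnorm_ge0 (x - x'); lra.
- move=> x y clx cly e e0.
  have e20 : 0 < e / 2 by rewrite divr_gt0.
  have norm1 (w : A) : 0 < cnorm w + 1 by rewrite ltr_wpDl ?cnorm_ge0.
  have [x' Gx xx'] := clx _ (divr_gt0 e20 (norm1 y)).
  have [y' Gy yy'] := cly _ (divr_gt0 e20 (norm1 x')).
  exists (x' * y'); first exact: Gm.
  have -> : x * y - x' * y' = (x - x') * y + x' * (y - y').
    by rewrite mulrBl mulrBr addrA subrK.
  apply: le_lt_trans (cnormD _ _) _.
  have := cnormM (x - x') y; have := cnormM x' (y - y').
  move: xx' yy'; rewrite !ltr_pdivlMr//.
  have := cnorm_ge0 (x - x'); have := cnorm_ge0 (y - y').
  by rewrite !mulrDr !mulr1 [_ * cnorm x']mulrC; lra.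
- move=> x clx e /clx [y Gy xy]; exists (star y); first exact: Gs.
  by rewrite -starB cnorm_eq_star.
move=> x clx e e0; have e20 : 0 < e / 2 by rewrite divr_gt0.
have [y cly xy] := clx _ e20; have [w Gw yw] := cly _ e20.
by exists w => //; have := cnorm_triangle y x w; lra.
Qed.

(** Closedness is the point: the lower bound on [B] makes the preimages of a convergent sequence
    Cauchy, their limit stays in [B], and contractivity of [f] identifies its image. *)
Lemma cstar_subalgebra_image (f : {lrmorphism A -> A}) B :
    (forall x, f (star x) = star (f x)) ->
    (forall x, B x -> cnorm x <= cnorm (f x)) ->
  cstar_subalgebra B -> cstar_subalgebra (f @` B).
Proof.
move=> fs iso [B0 Bl Bm Bs Bcl].
have BB x y : B x -> B y -> B (x - y).
  by move=> Bx By; rewrite addrC -scaleN1r; apply: Bl.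
split.
- by exists 0; rewrite ?raddf0.
- move=> a _ _ [x Bx <-] [y By <-]; exists (a *: x + y); first exact: Bl.
  by rewrite linearP.
- move=> _ _ [x Bx <-] [y By <-]; exists (x * y); first exact: Bm.
  by rewrite rmorphM.
- by move=> _ [x Bx <-]; exists (star x); [exact: Bs | exact: fs].
move=> y cly.
have app m : exists x, B x /\ cnorm (y - f x) < m.+1%:R^-1.
  by have [|_ [x Bx <-] yx] := cly m.+1%:R^-1; [rewrite invr_gt0 | exists x].
have [x xP] := choice app; pose Bx m := (xP m).1; pose fx m := (xP m).2.
have small (e : R) : 0 < e -> exists N, forall p, (N <= p)%N ->
    cnorm (y - f (x p)) < e.
  move=> e0; have [N _ HN] := near_infty_natSinv_lt (PosNum e0).
  by exists N => p /HN /=; apply: lt_trans (fx p).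
have [l xl] : exists l : A, cnorm (x p - l) @[p --> \oo] --> (0 : R).
  apply: cnorm_complete => e e0.
  have [|N HN] := small (e / 2); first by rewrite divr_gt0.
  exists ([set p | N <= p]%N, [set p | N <= p]%N) => /=.
    by split; exists N.
  move=> [p q] [/= /HN pN /HN qN].
  apply: le_lt_trans (iso _ (BB _ _ (Bx p) (Bx q))) _; rewrite raddfB.
  have := cnorm_triangle y (f (x p)) (f (x q)).
  by rewrite [cnorm (f (x p) - y)]cnormB; lra.
have {}xl (e : R) : 0 < e -> exists N, forall p, (N <= p)%N ->
    cnorm (x p - l) < e.
  move=> e0; move/cvgrPdist_lt: xl => /(_ _ e0) [N _ HN].
  by exists N => p /HN /=; rewrite sub0r normrN ger0_norm ?cnorm_ge0.
exists l.
  apply: Bcl => e /xl [N /(_ N (leqnn N)) Nl]; exists (x N) => //.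
  by rewrite cnormB.
apply/subr0_eq/cnorm_small_eq0 => e e0.
have e20 : 0 < e / 2 by rewrite divr_gt0.
have [N1 /(_ _ (leq_maxl _ _)) H1] := small _ e20.
have [N2 H2] := xl _ e20.
have := H1 N2; have := H2 _ (leq_maxr N1 N2).
have := star_rmorph_contractive f (x (maxn N1 N2) - l) fs; rewrite raddfB.
have := cnorm_triangle (f (x (maxn N1 N2))) (f l) y.
rewrite [cnorm (f l - f _)]cnormB [cnorm (y - f (x _))]cnormB; lra.
Qed.
End Subalgebras.

(** * Cuntz relations and the canonical shift *)

Section CuntzAlgebra.
Context {R : realType} {A : cstarAlgType R} {n : nat}.
Variable S : 'I_n -> A.
Hypothesis hS : cuntz_algebra S.
Local Notation phi := (cuntz_shift S).
Local Notation proj s := (word S s * star (word S s)).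

Let isoS i : star (S i) * S i = 1. Proof. by have [] := hS. Qed.
Let sumS : \sum_i S i * star (S i) = 1. Proof. by have [] := hS. Qed.

(* The elements [S_i^* S_j S_j^* S_i] with [j != i] sum to [0] and satisfy
   [|1 - a| <= 1], so each of them vanishes by extremality of [1]. *)
Lemma cuntz_orthogonal i j : i != j -> star (S i) * S j = 0.
Proof.
move=> ij; pose a l := star (S i) * (S l * star (S l)) * S i.
have a_sa l : star (a l) = a l by rewrite /a !(starM, starK) !mulrA.
(* [1 - a l] is the compression by the isometry [S i] of the projection [1 - S l * star (S l)]. *)
have a_pos l : cnorm (1 - a l) <= 1.
  have -> : 1 - a l = star (S i) * (1 - S l * star (S l)) * S i.
    by rewrite mulrBr mulr1 mulrBl isoS.
  apply: le_trans (cnorm_conj_le _ _ (cnorm_isometry_le _ (isoS i))) _.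
  apply: cnorm_projection_le; rewrite starB star1 starM starK mulrBl mul1r.
  rewrite mulrBr mulr1 -[_ * _ * (_ * _)]mulrA [star _ * (_ * _)]mulrA isoS.
  by rewrite mul1r subrr subr0.
have a0 : a i = 1 by rewrite /a mulrA isoS mul1r isoS.
have sum_a : a j + \sum_(l | (l != i) && (l != j)) a l = 0.
  have : \sum_l a l = 1 by rewrite -mulr_suml -mulr_sumr sumS mulr1 isoS.
  rewrite (bigD1 i)//= (bigD1 j) 1?eq_sym//= a0 => E.
  by apply: (addrI 1); rewrite addr0.
(* As [a j] is minus the sum of the [a l] over the [N] remaining indices, [N + a j] is a sum of [N]
   terms [1 - a l]. Hence adding [a j / (N + 1)] to 1, or subtracting it, stays in the unit ball. *)
set N := #|[pred l | (l != i) && (l != j)]|.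
have N1 : 0 < N.+1%:R^-1 :> R by rewrite invr_gt0.
have sum_pos : cnorm (1 *+ N + a j) <= N%:R.
  have -> : 1 *+ N + a j = \sum_(l | (l != i) && (l != j)) (1 - a l).
    rewrite sumrB sumr_const; congr +%R.
    by apply/eqP; rewrite -addr_eq0; apply/eqP.
  by rewrite -[N%:R]mulr1; apply: cnorm_sum_le => l _.
have norm_N : cnorm (1 *+ N : A) <= N%:R.
  rewrite -sumr_const -[N%:R]mulr1; apply: cnorm_sum_le => l _.
  exact: cnorm1_le.
have scaleN (x : A) : x = (N.+1%:R^-1)%:C%C *: (x *+ N.+1).
  rewrite -[x *+ _]scaler_nat -(rmorph_nat (real_complex R)) scalerA.
  by rewrite -rmorphM mulVf ?scale1r// pnatr_eq0.
have : (N.+1%:R^-1)%:C%C *: a j = 0.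
  apply: one_extreme.
  - by rewrite starZ a_sa; congr (_ *: _); exact: conjc_real.
  - rewrite {1}[1]scaleN -scalerDr cnorm_scale ?(ltW N1)// ler_pdivrMl// mulr1.
    rewrite mulrS -addrA; have := cnormD 1 (1 *+ N + a j).
    by rewrite -(natr1 N); have : cnorm (1 : A) <= 1 := cnorm1_le; lra.
  rewrite {1}[1]scaleN -scalerBr cnorm_scale ?(ltW N1)// ler_pdivrMl// mulr1.
  rewrite mulrSr -addrA; have := cnormD (1 *+ N) (1 - a j).
  by rewrite -(natr1 N); have := a_pos j; lra.
move/(congr1 (GRing.scale (N.+1%:R)%:C%C)).
rewrite scaler0 scalerA -rmorphM mulfV ?pnatr_eq0// scale1r => aj0.
apply: cnorm_eq0; rewrite -cnorm_eq_star starM starK; apply/eqP.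
rewrite -sqrf_eq0 -cnorm_star starM starK.
have -> : star (S i) * S j * (star (S j) * S i) = a j by rewrite /a !mulrA.
by rewrite aj0 cnorm0.
Qed.

(** The ranges of the [S j] being orthogonal, only the summand of index [i] survives. *)
Lemma shift_mulS x i : phi x * S i = S i * x.
Proof.
rewrite /cuntz_shift (bigD1 i)//= mulrDl -mulrA isoS mulr1 mulr_suml.
rewrite big1 ?addr0//.
by move=> j ji; rewrite -mulrA cuntz_orthogonal// mulr0.
Qed.

Lemma shift_star x : star (phi x) = phi (star x).
Proof.
by rewrite star_sum; apply: eq_bigr => i _; rewrite !starM starK mulrA.
Qed.

Lemma mulS_shift x i : star (S i) * phi x = x * star (S i).
Proof.
by apply: (can_inj starK); rewrite !starM shift_star !starK shift_mulS.
Qed.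

Lemma shiftM x y : phi (x * y) = phi x * phi y.
Proof.
rewrite {3}/cuntz_shift mulr_sumr; apply: eq_bigr => i _.
by rewrite !mulrA shift_mulS.
Qed.

Lemma shift1 : phi 1 = 1.
Proof. by rewrite -[RHS]sumS; apply: eq_bigr => i _; rewrite mulr1. Qed.

Lemma shiftP a x y : phi (a *: x + y) = a *: phi x + phi y.
Proof.
rewrite /cuntz_shift scaler_sumr -big_split/=; apply: eq_bigr => i _.
by rewrite mulrDr mulrDl -scalerAr -scalerAl.
Qed.

Lemma shift_bounded : exists2 M : R, 0 < M &
  forall x, cnorm (phi x) <= M * cnorm x.
Proof.
exists n.+1%:R => // x; apply: (@le_trans _ _ (n%:R * cnorm x)); last first.
  by rewrite ler_wpM2r ?cnorm_ge0// ler_nat.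
rewrite -[n in n%:R]card_ord; apply: cnorm_sum_le => i _.
have Si : cnorm (star (S i)) <= 1.
  by rewrite cnorm_eq_star; apply: cnorm_isometry_le; exact: isoS.
by rewrite -{1}(starK (S i)); apply: cnorm_conj_le.
Qed.

Lemma word_cons i s : word S (i :: s) = S i * word S s.
Proof. exact: big_cons. Qed.

Lemma word_nil : word S [::] = 1.
Proof. exact: big_nil. Qed.

Lemma iter_shift1 k : iter k phi 1 = 1.
Proof. by elim: k => //= k ->; exact: shift1. Qed.

Lemma iter_shiftM k x y : iter k phi (x * y) = iter k phi x * iter k phi y.
Proof. by elim: k => //= k ->; exact: shiftM. Qed.

Lemma iter_shift_star k x : star (iter k phi x) = iter k phi (star x).
Proof. by elim: k => //= k <-; exact: shift_star. Qed.

Lemma iter_shift_word k x s : size s = k ->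
  iter k phi x * word S s = word S s * x.
Proof.
move=> <-; elim: s => [|i s IH]; first by rewrite word_nil mulr1 mul1r.
by rewrite word_cons mulrA shift_mulS -mulrA IH mulrA.
Qed.

Lemma word_iter_shift k x s : size s = k ->
  star (word S s) * iter k phi x = x * star (word S s).
Proof.
move=> sk; apply: (can_inj starK).
by rewrite !starM iter_shift_star !starK iter_shift_word.
Qed.

(** For words [s], [t] of length [k], both products of [phi^k(x)] with [S_s S_t^*] equal
    [S_s x S_t^*]. *)
Lemma Fk_iter_shift_comm k y x : Fk S k y ->
  y * iter k phi x = iter k phi x * y.
Proof.
case=> c ->; rewrite mulr_suml mulr_sumr; apply: eq_bigr => s _.
rewrite mulr_suml mulr_sumr; apply: eq_bigr => t _.
rewrite -scalerAl -scalerAr -mulrA word_iter_shift ?size_tuple//.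
by rewrite !mulrA iter_shift_word ?size_tuple.
Qed.

Lemma proj_cons i s : proj (i :: s) = proj [:: i] * phi (proj s).
Proof.
rewrite !word_cons word_nil mulr1 -[S i * star _ * _]mulrA mulS_shift.
by rewrite starM !mulrA.
Qed.

Lemma shift_proj s : phi (proj s) = \sum_i proj (i :: s).
Proof. by apply: eq_bigr => i _; rewrite word_cons starM !mulrA. Qed.

(** * The diagonal subalgebra *)

Lemma Dn_subalgebra : cstar_subalgebra (Dn S).
Proof. exact: cstar_generated_subalgebra. Qed.

Lemma Dn_proj s : Dn S (proj s).
Proof. by apply: sub_cstar_generated; exists s. Qed.

Lemma Dn_min (B : set A) :
  cstar_subalgebra B -> (forall s, B (proj s)) -> Dn S `<=` B.
Proof. by move=> cB sB; apply: cstar_generated_min => // _ [s _ <-]. Qed.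

(** The preimage of [D_n] under the shift is a C*-subalgebra, and it contains each generator because
    [phi(P_s)] is the sum of the [P_(i s)]. *)
Lemma Dn_shift x : Dn S x -> Dn S (phi x).
Proof.
have [M M0 phiM] := shift_bounded.
apply: (Dn_min [set y | Dn S (phi y)]).
  apply: (cstar_subalgebra_preimage phi M) => //.
  - exact: shiftP.
  - exact: shiftM.
  - by move=> y; rewrite shift_star.
  exact: Dn_subalgebra.
move=> s /=; rewrite shift_proj.
have [D0 Dl _ _ _] := Dn_subalgebra.
apply: (@big_ind _ (Dn S)) => // [y y' Dy Dy'|i _]; last exact: Dn_proj.
by rewrite -[y]scale1r; apply: Dl.
Qed.

Lemma Dk1_proj i : Dk S 1 (proj [:: i]).
Proof.
split; first exact: Dn_proj.
exists (fun s t => ((s == [tuple i]) && (t == [tuple i]))%:R).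
rewrite (bigD1 [tuple i])//= [X in _ + X]big1 ?addr0; last first.
  by move=> s /negPf si; rewrite big1// => t _; rewrite si scale0r.
rewrite (bigD1 [tuple i])//= big1 ?addr0 ?eqxx ?scale1r//.
by move=> t /negPf ti; rewrite ti andbF scale0r.
Qed.

(** * The endomorphisms [lambda_w] and their cocycles *)

Section Endomorphism.
Variables (w : A) (f : {lrmorphism A -> A}).
Hypothesis hf : is_lambda S w f.

Let fstar x : f (star x) = star (f x). Proof. by case: hf. Qed.
Let fS i : f (S i) = w * S i. Proof. by case: hf. Qed.

Lemma lambda_Fk1 y : Fk S 1 y -> f y = w * y * star w.
Proof.
case=> c ->; rewrite linear_sum mulr_sumr mulr_suml; apply: eq_bigr => s _.
rewrite linear_sum mulr_sumr mulr_suml; apply: eq_bigr => t _.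
rewrite linearZ -scalerAr -scalerAl rmorphM /= fstar; congr (_ *: _).
have f_word (r : 1.-tuple 'I_n) : f (word S r) = w * word S r.
  by case/tupleP: r => i r; rewrite tuple0 /= word_cons word_nil mulr1.
by rewrite !f_word starM !mulrA.
Qed.

Lemma lambda_shift x : f (phi x) = w * phi (f x) * star w.
Proof.
rewrite linear_sum mulr_sumr mulr_suml; apply: eq_bigr => i _.
by rewrite !rmorphM /= fstar fS starM !mulrA.
Qed.

(** The product [w phi(w) ... phi^(j-1)(w)], for which [lambda_w(S_s) = cocycle j * S_s] when [s]
    has length [j]. *)
Definition cocycle (j : nat) : A := iter j (fun v => w * phi v) 1.

Hypothesis w_unitary : unitary w.

Lemma cocycle_unitary j : unitary (cocycle j).
Proof.
have [ww ww'] := w_unitary.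
elim: j => [|j [IH IH']]; first by rewrite /unitary star1 mulr1.
rewrite /cocycle /= -/(cocycle j); split.
  rewrite starM shift_star mulrA -[_ * star w * w]mulrA ww mulr1.
  by rewrite -shiftM IH shift1.
by rewrite starM shift_star mulrA -[w * _ * _]mulrA -shiftM IH' shift1 mulr1.
Qed.

(** Each letter is peeled off by [S_i v = phi(v) S_i]. Letting [j] exceed the length of [s] allows
    finitely many projections to share one unitary. *)
Lemma lambda_proj s j : (size s <= j)%N ->
  f (proj s) = cocycle j * proj s * star (cocycle j).
Proof.
elim: s j => [|i s IH] j; last case: j => // j sj.
  have [_ E] := cocycle_unitary j.
  by rewrite word_nil star1 mulr1 rmorph1 mulr1 E.
rewrite /cocycle /= -/(cocycle j) word_cons starM.
have -> : S i * word S s * (star (word S s) * star (S i)) =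
  S i * proj s * star (S i) by rewrite !mulrA.
rewrite rmorphM /= [f (S i * _)]rmorphM /= (IH j)// fstar fS !starM shift_star.
rewrite !mulrA -[w * phi _ * S i]mulrA shift_mulS.
by rewrite -[_ * star (S i) * phi _]mulrA mulS_shift !mulrA.
Qed.

(* On the algebraic span of the projections, [f] is eventually the conjugation
   by the unitary [cocycle j]. *)
Lemma lambda_isometric_Dn x : Dn S x -> cnorm x <= cnorm (f x).
Proof.
(* Requiring the formula for all large [j] gives any two elements a common index, so [G] is closed
   under sums and products. *)
pose G := [set y | exists m, forall j, (m <= j)%N ->
  f y = cocycle j * y * star (cocycle j)].
have G_iso y : G y -> cnorm y <= cnorm (f y).
  case=> m /(_ m (leqnn m)) fy; have [E _] := cocycle_unitary m.
  have yE : y = star (cocycle m) * f y * cocycle m.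
    by rewrite fy !mulrA E mul1r -mulrA E mulr1.
  by rewrite {1}yE; apply/cnorm_conj_le/cnorm_isometry_le.
have : Dn S `<=` norm_closure G.
  apply: Dn_min; last first.
    move=> s e e0; exists (proj s); last by rewrite subrr cnorm0.
    by exists (size s) => j; exact: lambda_proj.
  apply: cstar_subalgebra_norm_closure.
  - by exists 0%N => j _; rewrite raddf0 mulr0 mul0r.
  - move=> a y y' [m fy] [m' fy']; exists (maxn m m') => j.
    rewrite geq_max => /andP[/fy E /fy' E'].
    by rewrite linearP /= E E' mulrDr mulrDl -scalerAr -scalerAl.
  - move=> y y' [m fy] [m' fy']; exists (maxn m m') => j.
    rewrite geq_max => /andP[/fy E /fy' E']; have [ww _] := cocycle_unitary j.
    by rewrite rmorphM /= E E' !mulrA -[_ * star _ * cocycle j]mulrA ww mulr1.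
  - move=> y [m fy]; exists m => j /fy E.
    by rewrite fstar E !starM starK mulrA.
move=> clG /clG Gx; apply/ler_addgt0Pl => e e0.
have [|y Gy xy] := Gx (e / 2); first by rewrite divr_gt0.
have := G_iso _ Gy; have := cnorm_le_add x y; have := cnorm_le_add (f y) (f x).
have := star_rmorph_contractive f (x - y) fstar.
by rewrite raddfB [cnorm (f x - _)]cnormB; lra.
Qed.

End Endomorphism.
End CuntzAlgebra.

(** * Invariance of [lambda_z(D_n)] *)

Theorem corollary4p3 (R : realType) (n : nat) (hn : (2 <= n)%N)
    (A : cstarAlgType R) (S : 'I_n -> A) (hS : cuntz_algebra S)
    (k : nat) (hk : (0 < k)%N) (u z : A)
    (uF : Fk S k u) (u_unitary : unitary u)
    (zF : Fk S 1 z) (z_unitary : unitary z)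
    (lambda_u lambda_z : {lrmorphism A -> A})
    (hlu : is_lambda S u lambda_u) (hlz : is_lambda S z lambda_z) :
  conj_set u (conj_set z (Dk S 1)) =
    iter k.-1 (cuntz_shift S) @` conj_set z (Dk S 1) ->
  lambda_u @` (lambda_z @` Dn S) `<=` lambda_z @` Dn S.
Proof.
move=> hconj; set B := lambda_z @` Dn S.
have [u_star _] := hlu; have [z_star _] := hlz.
have cB : cstar_subalgebra B.
  apply: cstar_subalgebra_image => //; last exact: Dn_subalgebra.
  exact: lambda_isometric_Dn hS _ _ hlz z_unitary.
(* The conjugation by [z] in [lambda_z (phi x)] cancels, as [z] in [F_n^1] commutes with the range
   of [phi]. *)
have lambda_z_shift j x : lambda_z (iter j (cuntz_shift S) x) =
    iter j (cuntz_shift S) (lambda_z x).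
  elim: j => //= j <-; rewrite (lambda_shift _ _ _ hlz).
  have /= -> := Fk_iter_shift_comm S hS 1 z
    (lambda_z (iter j (cuntz_shift S) x)) zF.
  by rewrite -mulrA (proj2 z_unitary) mulr1.
(* For [j = 0], [lambda_u] conjugates each of [z], [d] and [star z] by [u], and [hconj] supplies
   [q']. The same [q'] then serves for every [j]. *)
have lambda_u_shift j q : conj_set z (Dk S 1) q -> exists2 q',
    conj_set z (Dk S 1) q' &
    lambda_u (iter j (cuntz_shift S) q) = iter (j + k.-1) (cuntz_shift S) q'.
  move=> zq; elim: j => [|j [q' zq' E]].
    have : conj_set u (conj_set z (Dk S 1)) (lambda_u q).
      exists q => //; case: zq => d [_ dF] <-.
      rewrite !rmorphM /= u_star !(lambda_Fk1 S u lambda_u)//.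
      rewrite !starM starK -!mulrA; do 2!congr (_ * _).
      by rewrite !(mulrA (star u) u) (proj1 u_unitary) !mul1r.
    by rewrite hconj => -[q' zq' <-]; exists q'.
  exists q' => //=; rewrite (lambda_shift _ _ _ hlu) E.
  rewrite -[cuntz_shift S _]/(iter (j + k.-1).+1 (cuntz_shift S) q').
  (* Positivity of [k] makes the exponent [j + k], exposing an outer [phi^k] whose range commutes
     with [u]. *)
  rewrite -addnS prednK// addnC iterD.
  by rewrite Fk_iter_shift_comm// -mulrA (proj2 u_unitary) mulr1.
have B_shift j q : conj_set z (Dk S 1) q -> B (iter j (cuntz_shift S) q).
  case=> d [dD dF] <-; rewrite -(lambda_Fk1 S z lambda_z)// -lambda_z_shift.
  by exists (iter j (cuntz_shift S) d) => //; elim: j => //= j; exact: Dn_shift.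
(* The exponent [j] is generalized because [phi^j(P_(i s)) = phi^j(P_i) phi^(j+1)(P_s)]: the head is
   covered by [lambda_u_shift], the tail by induction at [j + 1]. *)
have B_proj s j : B (lambda_u (lambda_z
    (iter j (cuntz_shift S) (word S s * star (word S s))))).
  elim: s j => [|i s IH] j.
    rewrite word_nil star1 mulr1 iter_shift1// !rmorph1.
    exists 1; rewrite ?rmorph1//.
    by have := Dn_proj S [::]; rewrite word_nil star1 mulr1.
  rewrite proj_cons// iter_shiftM// -iterSr !rmorphM /=.
  have [_ _ Bm _ _] := cB.
  apply: Bm; last exact: (IH j.+1).
  have [D F] := Dk1_proj S i.
  rewrite lambda_z_shift (lambda_Fk1 S z lambda_z)//.
  set p := word S [:: i] * star (word S [:: i]).
  have [|q' zq' ->] := lambda_u_shift j (z * p * star z); first by exists p.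
  exact: B_shift.
move=> _ [_ [x Dx <-] <-]; move: x Dx.
(* From the projections to [D_n]: the preimage of [B] under the contractive map
   [lambda_u \o lambda_z] is a C*-subalgebra. *)
apply: (Dn_min S [set x | B (lambda_u (lambda_z x))]) => [|s];
  last exact: (B_proj s 0%N).
apply: (cstar_subalgebra_preimage (lambda_u \o lambda_z) 1) => //=.
- by move=> a x y; rewrite !linearP.
- by move=> x y; rewrite !rmorphM.
- by move=> x; rewrite z_star u_star.
move=> x; rewrite mul1r; apply: le_trans (star_rmorph_contractive _ _ z_star).
exact: star_rmorph_contractive.
Qed.
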